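(* Let $f=\frac1n\sum_{i=1}^n f_i$ be convex, and suppose each $f_i$ is $L_i$-smooth for some $L_i>0$. Let $L=\max_{1\le i\le n}L_i$, let $\mu\in(0,2/L]$, and let the integers $t(k)\ge 1$ satisfy $\sum_{k=0}^\infty \beta^{t(k)}<\infty$. Let $\{\mathbf{x}_k\}$ be generated by NEAR-DGD$^+$ from an arbitrary initial point $\mathbf{x}_0\in\mathbb{R}^{np}$. Then for any minimizer $x_*\in X^*$, with $\mathbf{x}_*:=1_n\otimes x_*=(x_*^\top,\dots,x_*^\top)^\top$, $$\|\bar{\mathbf{x}}_k-\mathbf{x}_*\|=O(1)\quad\text{and}\quad \|\bar{\mathbf{x}}_{k+1}-\mathbf{x}_{k+1}\|=O(\beta^{t(k)})\qquad (k\to\infty).$$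
   Context: Let $n,p\in\mathbb{N}$. $W=(w_{ij})$ is an $n\times n$ doubly stochastic matrix whose associated directed graph is strongly connected and has a self-loop at every vertex ($w_{ii}>0$ for all $i$). $1_n\in\mathbb{R}^n$ is the all-ones vector, and $\beta\in[0,1)$ denotes the spectral norm of $W-\frac1n1_n1_n^\top$. Local costs $f_i:\mathbb{R}^p\to\mathbb{R}$ are differentiable, $f=\frac1n\sum_{i=1}^n f_i$, $f^*=\min f$, and $X^*=\{x: f(x)=f^*\}$ is assumed nonempty. A function $h$ is $L$-smooth if $\|\nabla h(x)-\nabla h(y)\|\le L\|x-y\|$ for all $x,y$. For $\mathbf{x}=(x_1^\top,\dots,x_n^\top)^\top\in\mathbb{R}^{np}$ write $\nabla F(\mathbf{x})=(\nabla f_1(x_1)^\top,\dots,\nabla f_n(x_n)^\top)^\top$. NEAR-DGD$^+$ with step size $\mu>0$ and consensus numbers $t(k)\in\mathbb{N}$ is the iteration $\mathbf{x}_{k+1}=(W^{t(k)}\otimes I_p)(\mathbf{x}_k-\mu\nabla F(\mathbf{x}_k))$, $k\ge0$, where $\otimes$ is the Kronecker product and $I_p$ the $p\times p$ identity. Writing $\mathbf{x}_k=(x_{1,k}^\top,\dots,x_{n,k}^\top)^\top$, set $\bar x_k=\frac1n\sum_{i=1}^n x_{i,k}\in\mathbb{R}^p$ and $\bar{\mathbf{x}}_k=1_n\otimes\bar x_k\in\mathbb{R}^{np}$. $\|\cdot\|$ is the Euclidean norm. *)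

(* Defs.v *)
From HB Require Import structures.
From mathcomp Require Import all_boot all_order all_algebra.
From mathcomp Require Import all_classical all_reals all_analysis.
Set Implicit Arguments. Unset Strict Implicit. Unset Printing Implicit Defensive.
Import Order.TTheory GRing.Theory Num.Theory.
Import numFieldNormedType.Exports.
Local Open Scope classical_set_scope.
Local Open Scope ring_scope.

Section Defs.
Variable R : realType.

Definition e2norm (m k : nat) (A : 'M[R]_(m, k)) : R :=
  Num.sqrt (\sum_i \sum_j A i j ^+ 2).

Definition spec_norm (n : nat) (A : 'M[R]_n) : R :=
  sup [set e2norm (A *m v) | v in [set v : 'cV[R]_n | e2norm v <= 1]].

Definition doubly_stochastic (n : nat) (W : 'M[R]_n) : Prop :=
  [/\ forall i j, 0 <= W i j,
      forall i, \sum_j W i j = 1 &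
      forall j, \sum_i W i j = 1].

Definition mx_graph (n : nat) (W : 'M[R]_n) : rel 'I_n := fun i j => 0 < W i j.

Definition strongly_connected (n : nat) (W : 'M[R]_n) : Prop :=
  forall i j : 'I_n, connect (mx_graph W) i j.

Definition self_loops (n : nat) (W : 'M[R]_n) : Prop := forall i, 0 < W i i.

Definition grad (p : nat) (f : 'rV[R]_p -> R) (x : 'rV[R]_p) : 'rV[R]_p :=
  \row_j ('d f x (delta_mx 0 j)).

Definition convex_fun (p : nat) (f : 'rV[R]_p -> R) : Prop :=
  forall (a : R) (x y : 'rV[R]_p), 0 <= a <= 1 ->
    f (a *: x + (1 - a) *: y) <= a * f x + (1 - a) * f y.

Definition L_smooth (p : nat) (L : R) (f : 'rV[R]_p -> R) : Prop :=
  forall x y, e2norm (grad f x - grad f y) <= L * e2norm (x - y).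

Definition avg_fun (n p : nat) (fs : 'I_n -> 'rV[R]_p -> R) (x : 'rV[R]_p) : R :=
  n%:R^-1 * \sum_i fs i x.

(* A stacked vector x in R^{np} is represented as the n x p matrix whose
   i-th row is x_i; then (W^t (x) I_p) x corresponds to W^t *m X. *)
Definition gradF (n p : nat) (fs : 'I_n -> 'rV[R]_p -> R) (X : 'M[R]_(n, p))
  : 'M[R]_(n, p) := \matrix_(i, j) grad (fs i) (row i X) 0 j.

Definition near_dgd_plus (n p : nat) (W : 'M[R]_n) (fs : 'I_n -> 'rV[R]_p -> R)
  (mu : R) (t : nat -> nat) (X : nat -> 'M[R]_(n, p)) : Prop :=
  forall k, X k.+1 = (W ^+ t k) *m (X k - mu *: gradF fs (X k)).

Definition xbar (n p : nat) (X : 'M[R]_(n, p)) : 'rV[R]_p :=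
  \row_j (n%:R^-1 * \sum_i X i j).

Definition stack (n p : nat) (v : 'rV[R]_p) : 'M[R]_(n, p) :=
  \matrix_(i, j) v 0 j.

End Defs.

(* Main.v *)
Require Import Defs.
From HB Require Import structures.
From mathcomp Require Import all_boot all_order all_algebra ring lra.
From mathcomp Require Import all_classical all_reals all_analysis.
Import Order.TTheory GRing.Theory Num.Theory.
Import numFieldNormedType.Exports.
Local Open Scope classical_set_scope.
Local Open Scope ring_scope.

(** Write E k for the distance of the average to the minimizer and d k for the
    consensus error, both measured in R^{np}. Averaging the iteration gives a
    gradient step of the convex function f at the average, perturbed by at most
    mu * L * d k; since mu <= 2 / L the exact step does not increase the distance
    to a minimizer, so E (k+1) <= E k + mu * L * d k. Since (W - P)^t = W^t - P
    for t >= 1, where P is the averaging matrix, one gets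
    d (k+1) <= beta^(t k) * (c * (E k + d k) + K). Hence E + c * d + K grows by a
    factor of at most 1 + c^2 * beta^(t k) per step, and summability of
    beta^(t k) keeps it bounded. *)

(** * Frobenius inner product, Cauchy-Schwarz, and norm bounds by rows and columns *)

Definition frob {R : realType} {m k : nat} (A B : 'M[R]_(m, k)) : R :=
  \sum_i \sum_j A i j * B i j.

Section Frobenius.
Context {R : realType} {m k : nat}.
Implicit Types A B C : 'M[R]_(m, k).

Lemma frobC A B : frob A B = frob B A.
Proof. by apply: eq_bigr => i _; apply: eq_bigr => j _; rewrite mulrC. Qed.

Lemma frobDl A B C : frob (A + B) C = frob A C + frob B C.
Proof.
rewrite /frob -big_split; apply: eq_bigr => i _; rewrite -big_split.
by apply: eq_bigr => j _; rewrite mxE mulrDl.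
Qed.

Lemma frobZl (a : R) A B : frob (a *: A) B = a * frob A B.
Proof.
rewrite /frob mulr_sumr; apply: eq_bigr => i _; rewrite mulr_sumr.
by apply: eq_bigr => j _; rewrite mxE mulrA.
Qed.

Lemma frobNl A B : frob (- A) B = - frob A B.
Proof. by rewrite -scaleN1r frobZl mulN1r. Qed.

Lemma frobDr A B C : frob A (B + C) = frob A B + frob A C.
Proof. by rewrite ![frob A _]frobC frobDl. Qed.

Lemma frobZr (a : R) A B : frob A (a *: B) = a * frob A B.
Proof. by rewrite ![frob A _]frobC frobZl. Qed.

Lemma frobNr A B : frob A (- B) = - frob A B.
Proof. by rewrite ![frob A _]frobC frobNl. Qed.

Definition frobE := (frobDl, frobDr, frobNl, frobNr, frobZl, frobZr).

Lemma frob_ge0 A : 0 <= frob A A.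
Proof. by do 2!apply: sumr_ge0 => ? _; rewrite -expr2 sqr_ge0. Qed.

Lemma e2norm_frob A : e2norm A = Num.sqrt (frob A A).
Proof. by []. Qed.

Lemma e2norm_sqr A : e2norm A ^+ 2 = frob A A.
Proof. by rewrite e2norm_frob sqr_sqrtr ?frob_ge0. Qed.

Lemma e2norm_ge0 A : 0 <= e2norm A.
Proof. exact: sqrtr_ge0. Qed.

Lemma e2norm_eq0 A : (e2norm A == 0) = (A == 0).
Proof.
apply/eqP/eqP => [A0|->]; last first.
  by rewrite e2norm_frob -(scale0r 0) frobZl mul0r sqrtr0.
have := e2norm_sqr A; rewrite A0 expr0n /= => /esym.
have sqA i j : 0 <= A i j * A i j by rewrite -expr2 sqr_ge0.
move/(psumr_eq0P (fun i _ => sumr_ge0 _ (fun j _ => sqA i j))) => A0'.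
apply/matrixP => i j; rewrite mxE; apply/eqP.
by rewrite -[_ == 0]orbb -mulf_eq0 (psumr_eq0P (fun j _ => sqA i j) (A0' i _)).
Qed.

Lemma le_e2norm_sqr A (a : R) : 0 <= a -> (e2norm A <= a) = (frob A A <= a ^+ 2).
Proof. by move=> a0; rewrite -e2norm_sqr ler_pXn2r ?nnegrE ?e2norm_ge0. Qed.

Lemma e2normZ (a : R) A : e2norm (a *: A) = `|a| * e2norm A.
Proof.
by rewrite !e2norm_frob !frobE mulrA -expr2 sqrtrM ?sqr_ge0// sqrtr_sqr.
Qed.

Lemma e2normN A : e2norm (- A) = e2norm A.
Proof. by rewrite -scaleN1r e2normZ normrN1 mul1r. Qed.

Lemma e2norm_subC A B : e2norm (A - B) = e2norm (B - A).
Proof. by rewrite -e2normN opprB. Qed.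

(** Cauchy-Schwarz. With a, b the norms of [A], [B], the square of b A - a B equals 2ab(ab -
    [frob A B]) and is nonnegative; zero matrices are split off first so that ab can be
    cancelled. *)
Lemma frob_le A B : frob A B <= e2norm A * e2norm B.
Proof.
have [A0|] := eqVneq A 0.
  by rewrite A0 -(scale0r 0) frobZl mul0r mulr_ge0 ?e2norm_ge0.
rewrite -e2norm_eq0 => nA; have [B0|] := eqVneq B 0.
  by rewrite B0 -(scale0r 0) frobZr mul0r mulr_ge0 ?e2norm_ge0.
rewrite -e2norm_eq0 => nB.
have ab : 0 < e2norm A * e2norm B by rewrite mulr_gt0 ?lt0r ?e2norm_ge0 ?nA ?nB.
have := frob_ge0 (e2norm B *: A - e2norm A *: B).
rewrite !frobE -!e2norm_sqr [frob B A]frobC => h.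
by rewrite -(ler_pM2l ab); nra.
Qed.

Lemma e2normD A B : e2norm (A + B) <= e2norm A + e2norm B.
Proof.
rewrite le_e2norm_sqr ?addr_ge0 ?e2norm_ge0// !frobE [frob B A]frobC.
by rewrite sqrrD !e2norm_sqr; have := frob_le A B; lra.
Qed.

End Frobenius.

Lemma frob_sum_col {R : realType} {m k} (A B : 'M[R]_(m, k)) :
  frob A B = \sum_j frob (col j A) (col j B).
Proof.
rewrite /frob exchange_big; apply: eq_bigr => j _; apply: eq_bigr => i _.
by rewrite big_ord1 !mxE.
Qed.

Lemma frob_sum_row {R : realType} {m k} (A B : 'M[R]_(m, k)) :
  frob A B = \sum_i frob (row i A) (row i B).
Proof.
apply: eq_bigr => i _; rewrite /frob big_ord1.
by apply: eq_bigr => j _; rewrite !mxE.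
Qed.

(** Squared norms add up over columns, so a bound for vectors extends to matrices with the same
    constant. *)
Lemma e2norm_le_col {R : realType} {m m' k} (A : 'M[R]_(m, k))
    (B : 'M[R]_(m', k)) (s : R) : 0 <= s ->
  (forall j, e2norm (col j A) <= s * e2norm (col j B)) ->
  e2norm A <= s * e2norm B.
Proof.
move=> s0 h; rewrite le_e2norm_sqr ?mulr_ge0 ?e2norm_ge0//.
rewrite exprMn e2norm_sqr frob_sum_col [frob B B]frob_sum_col mulr_sumr.
apply: ler_sum => j _; rewrite -[in leRHS]e2norm_sqr -exprMn.
by rewrite -le_e2norm_sqr ?mulr_ge0 ?e2norm_ge0.
Qed.

Lemma e2norm_le_row {R : realType} {m k k'} (A : 'M[R]_(m, k))
    (B : 'M[R]_(m, k')) (s : R) : 0 <= s ->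
  (forall i, e2norm (row i A) <= s * e2norm (row i B)) ->
  e2norm A <= s * e2norm B.
Proof.
move=> s0 h; rewrite le_e2norm_sqr ?mulr_ge0 ?e2norm_ge0//.
rewrite exprMn e2norm_sqr frob_sum_row [frob B B]frob_sum_row mulr_sumr.
apply: ler_sum => i _; rewrite -[in leRHS]e2norm_sqr -exprMn.
by rewrite -le_e2norm_sqr ?mulr_ge0 ?e2norm_ge0.
Qed.

(** Cauchy-Schwarz in each row. Its purpose is to bound the set whose supremum defines
    [spec_norm]. *)
Lemma e2norm_mulmx {R : realType} {m n} (A : 'M[R]_(m, n)) (v : 'cV[R]_n) :
  e2norm (A *m v) <= e2norm A * e2norm v.
Proof.
rewrite mulrC; apply: e2norm_le_row; first exact: e2norm_ge0.
move=> i; rewrite row_mul mulrC; move: (row i A) => u.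
have -> : e2norm v = e2norm v^T.
  rewrite !e2norm_frob /frob exchange_big/=; congr Num.sqrt.
  by apply: eq_bigr => ? _; apply: eq_bigr => ? _; rewrite mxE.
rewrite e2norm_frob /frob !big_ord1 -expr2 sqrtr_sqr mxE.
have -> : \sum_j u 0 j * v j 0 = frob u v^T.
  by rewrite /frob big_ord1; apply: eq_bigr => j _; rewrite mxE.
rewrite ler_norml frob_le andbT lerNl -frobNl -[e2norm u]e2normN.
exact: frob_le.
Qed.

(** * The spectral norm as an operator bound *)

Section SpectralNorm.
Context {R : realType} {n : nat}.
Implicit Type A : 'M[R]_n.

(** The set under [sup] is bounded by [e2norm A], so [sup] is a genuine supremum and not a default
    value. *)
Lemma spec_norm_ub A (v : 'cV[R]_n) :
  e2norm v <= 1 -> e2norm (A *m v) <= spec_norm A.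
Proof.
move=> v1; apply: ub_le_sup; last by exists v.
exists (e2norm A) => _ [w w1 <-]; apply: le_trans (e2norm_mulmx _ _) _.
by rewrite ler_piMr ?e2norm_ge0.
Qed.

Lemma spec_norm_ge0 A : 0 <= spec_norm A.
Proof.
apply: le_trans (e2norm_ge0 (A *m (0 : 'cV_n))) (spec_norm_ub _ _ _).
by rewrite (eqP (_ : e2norm 0 == 0)) ?e2norm_eq0 ?ler01.
Qed.

(** Each nonzero column is normalized to land in the unit ball over which the supremum is taken. *)
Lemma e2norm_mul_spec A p (B : 'M[R]_(n, p)) :
  e2norm (A *m B) <= spec_norm A * e2norm B.
Proof.
apply: e2norm_le_col (spec_norm_ge0 _) _ => j; rewrite colE -mulmxA -colE.
move: (col j B) => v; have [v0|] := eqVneq v 0.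
  have -> : e2norm (A *m v) = 0 by apply/eqP; rewrite e2norm_eq0 v0 mulmx0.
  by rewrite mulr_ge0 ?spec_norm_ge0 ?e2norm_ge0.
rewrite -e2norm_eq0 => nv; have vpos : 0 < e2norm v by rewrite lt0r nv e2norm_ge0.
rewrite -ler_pdivrMr// mulrC.
have -> : (e2norm v)^-1 * e2norm (A *m v) = e2norm (A *m ((e2norm v)^-1 *: v)).
  by rewrite -scalemxAr e2normZ ger0_norm ?invr_ge0 ?e2norm_ge0.
by apply: spec_norm_ub; rewrite e2normZ ger0_norm ?invr_ge0 ?e2norm_ge0 ?mulVf.
Qed.

Lemma e2norm_expmx_spec A t p (B : 'M[R]_(n, p)) :
  e2norm (A ^+ t *m B) <= spec_norm A ^+ t * e2norm B.
Proof.
elim: t => [|t IH]; first by rewrite !expr0 mul1mx mul1r.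
rewrite !exprS -[A * _]/(A *m _) -mulmxA -mulrA.
by apply: le_trans (e2norm_mul_spec _ _ _) _; rewrite ler_wpM2l ?spec_norm_ge0.
Qed.
End SpectralNorm.

(** * Smooth convex functions and the exact gradient step *)

Lemma frob_grad {R : realType} {p} (f : 'rV[R]_p -> R) (x v : 'rV[R]_p) :
  frob (grad f x) v = 'd f x v.
Proof.
rewrite [in RHS](row_sum_delta v) linear_sum /frob big_ord1.
by apply: eq_bigr => j _; rewrite linearZ mxE mulrC.
Qed.

Lemma is_derive_line {R : realType} {V : normedModType R} (f : V -> R)
    (x v : V) (s d : R) :
  is_derive (x + s *: v) v f d -> is_derive s 1 (fun s => f (x + s *: v)) d.
Proof.
move=> [fv <-].
have E : (fun h => h^-1 *: (((fun s => f (x + s *: v)) \o shift s) (h *: 1) -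
    f (x + s *: v))) =
  (fun h => h^-1 *: ((f \o shift (x + s *: v)) (h *: v) - f (x + s *: v))).
  apply/funext => h /=; congr (_ *: (f _ - _)).
  by rewrite -[h%:A]/(h * 1) mulr1 scalerDl addrCA.
by split; rewrite /derivable /derive E.
Qed.

Section SmoothConvex.
Context {R : realType} {p : nat}.
Implicit Types (f : 'rV[R]_p -> R) (g : 'rV[R]_p -> 'rV[R]_p) (x y v : 'rV[R]_p).

(** Descent lemma. The gradient is an abstract map [g], so that the result also applies to [- f]. *)
Lemma smooth_le f g (L : R) x v :
  (forall x v, is_derive x v f (frob (g x) v)) ->
  (forall x y, e2norm (g x - g y) <= L * e2norm (x - y)) ->
  f (x + v) <= f x + frob (g x) v + L / 2 * frob v v.
Proof.
move=> fg gL.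
(* The restriction of [f] to the segment minus its quadratic model: the Lipschitz bound makes the
   derivative of [h] nonpositive for s > 0, and the mean value theorem gives h(1) <= h(0). *)
pose h s := f (x + s *: v) - s * (frob (g x) v) - s ^+ 2 * (L / 2 * frob v v).
pose dh s := frob (g (x + s *: v)) v - frob (g x) v - s * (L * frob v v).
have hE (s : R) : is_derive s 1 h (dh s).
  have hs := is_derive_line f x v s _ (fg _ v).
  apply: is_derive_eq.
  rewrite /dh /GRing.scale/=; lra.
have hc : {within `[0, 1], continuous h}.
  by apply: derivable_within_continuous => s _; exact: (@ex_derive _ _ _ _ _ _ _ (hE s)).
have [c /[!in_itv]/= /andP[c0 _]] := MVT ltr01 (fun s _ => hE s) hc.
rewrite subr0 mulr1 => hdh.
have : dh c <= 0.
  rewrite /dh -frobNl -frobDl subr_le0.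
  apply: le_trans (frob_le _ _) _; rewrite -e2norm_sqr expr2 !mulrA.
  rewrite ler_wpM2r ?e2norm_ge0//.
  apply: le_trans (gL _ _) _; rewrite addrC addKr e2normZ gtr0_norm//.
  by rewrite mulrCA mulrA.
rewrite -hdh /h scale1r scale0r addr0 expr1n expr0n /=; lra.
Qed.

Lemma smooth_ge f g (L : R) x v :
  (forall x v, is_derive x v f (frob (g x) v)) ->
  (forall x y, e2norm (g x - g y) <= L * e2norm (x - y)) ->
  f x + frob (g x) v - L / 2 * frob v v <= f (x + v).
Proof.
move=> fg gL; have := @smooth_le (- f) (fun x => - g x) L x v.
rewrite frobNl !fctE => H; suff : - f (x + v) <= - f x - frob (g x) v + L / 2 * frob v v by lra.
apply: H => [y w|y z]; first by rewrite frobNl; exact: is_deriveN.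
by rewrite -opprD e2normN.
Qed.

Lemma convex_ge_tangent f g (L : R) x y :
  (forall x v, is_derive x v f (frob (g x) v)) ->
  (forall x y, e2norm (g x - g y) <= L * e2norm (x - y)) ->
  convex_fun f -> f x + frob (g x) (y - x) <= f y.
Proof.
move=> fg gL fcvx; set d := frob _ _; set q := L / 2 * frob (y - x) (y - x).
(* Convexity bounds [f] above at x + s(y - x), smoothness bounds it below; dividing by s leaves a
   defect of order s. *)
have key (s : R) : 0 < s <= 1 -> d - (f y - f x) <= s * q.
  move=> /andP[s0 s1]; have := fcvx s y x; rewrite (ltW s0) s1 => /(_ isT).
  have -> : s *: y + (1 - s) *: x = x + s *: (y - x).
    by rewrite scalerBl scale1r scalerBr addrCA addrA.
  have := smooth_ge f g L x (s *: (y - x)) fg gL.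
  rewrite frobZr frobZl frobZr -/d => h1 h2.
  rewrite -(ler_pM2l s0) /q; lra.
rewrite -subr_ge0 leNgt; apply/negP => neg.
have e0 : 0 < d - (f y - f x) by lra.
have q0 : 0 < q by have := key 1; rewrite ltr01 lexx => /(_ isT); lra.
(* This s makes s q at most half of the supposedly positive defect, a contradiction. *)
have := key (Num.min 1 ((d - (f y - f x)) / q / 2)).
rewrite lt_min ltr01 !divr_gt0//= ge_min lexx/= => /(_ isT).
have : Num.min 1 ((d - (f y - f x)) / q / 2) * q <= (d - (f y - f x)) / 2.
  rewrite -ler_pdivlMr// ge_min; apply/orP; right; rewrite [leRHS]mulrAC; lra.
lra.
Qed.

(* Baillon-Haddad at a minimizer: the tangent inequality at [x], evaluated at
   [xs + g x / L], is compared with the quadratic upper bound at [xs]. *)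
Lemma cocoercive_min f g (L : R) x xs : 0 < L ->
  (forall x v, is_derive x v f (frob (g x) v)) ->
  (forall x y, e2norm (g x - g y) <= L * e2norm (x - y)) ->
  convex_fun f -> (forall y, f xs <= f y) ->
  frob (g x) (g x) / L <= frob (g x) (x - xs).
Proof.
move=> L0 fg gL fcvx fmin.
(* A gradient step of length 1/L from [y] lowers [f] by at least |g y|^2 / (2L), and cannot go below
   the minimum. *)
have decr y : f xs + frob (g y) (g y) / L / 2 <= f y.
  have := smooth_le f g L y (- L^-1 *: g y) fg gL.
  rewrite !frobE; have := fmin (y + - L^-1 *: g y).
  suff -> : L / 2 * (- L^-1 * (- L^-1 * frob (g y) (g y))) = frob (g y) (g y) / L / 2 by lra.
  by field; rewrite gt_eqF.
(* Applying [decr] at the minimizer itself forces its gradient to vanish. *)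
have g0 : frob (g xs) (g xs) = 0.
  apply/eqP; rewrite eq_le frob_ge0 andbT; have := decr xs.
  rewrite gerDl pmulr_lle0 ?invr_gt0// pmulr_lle0 ?invr_gt0//.
have gxs : g xs = 0.
  by apply/eqP; rewrite -e2norm_eq0 -sqrf_eq0 e2norm_sqr g0.
have := convex_ge_tangent f g L x (xs + L^-1 *: g x) fg gL fcvx.
have := smooth_le f g L xs (L^-1 *: g x) fg gL.
have := decr x.
rewrite gxs !frobE -(scale0r 0) frobZl mul0r.
have -> : L / 2 * (L^-1 * (L^-1 * frob (g x) (g x))) = frob (g x) (g x) / L / 2.
  by field; rewrite gt_eqF.
lra.
Qed.

(** With w = x - xs, the squared distance changes by mu^2 |g|^2 - 2 mu <g, w>. As mu <= 2/L,
    cocoercivity gives mu |g|^2 <= 2 |g|^2 / L <= 2 <g, w>. *)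
Lemma gradient_step_le f g (L mu : R) x xs : 0 < L -> 0 <= mu <= 2 / L ->
  (forall x v, is_derive x v f (frob (g x) v)) ->
  (forall x y, e2norm (g x - g y) <= L * e2norm (x - y)) ->
  convex_fun f -> (forall y, f xs <= f y) ->
  e2norm (x - mu *: g x - xs) <= e2norm (x - xs).
Proof.
move=> L0 /andP[mu0 muL] fg gL fcvx fmin.
rewrite le_e2norm_sqr ?e2norm_ge0// e2norm_sqr addrAC.
have := cocoercive_min f g L x xs L0 fg gL fcvx fmin.
move: (x - xs) => w co; rewrite !frobE [frob w (g x)]frobC.
have := frob_ge0 (g x); set G := frob (g x) (g x) in co * => G0.
suff : mu * (mu * G) <= 2 * (mu * frob (g x) w) by lra.
have : mu * G <= 2 * (G / L) by have := ler_wpM2r G0 muL; lra.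
nra.
Qed.
End SmoothConvex.

(** * The averaging projection [P], powers of [W], and the averaged gradient *)

Lemma frob_mxtrace {R : realType} {m k} (A B : 'M[R]_(m, k)) :
  frob A B = \tr (A *m B^T).
Proof.
apply: eq_bigr => i _; rewrite mxE.
by apply: eq_bigr => j _; rewrite mxE.
Qed.

Lemma frob_mulmxl {R : realType} {m n k} (M : 'M[R]_(m, n))
    (A : 'M[R]_(n, k)) (B : 'M[R]_(m, k)) :
  frob (M *m A) B = frob A (M^T *m B).
Proof.
by rewrite !frob_mxtrace trmx_mul trmxK mulmxA -mulmxA mxtrace_mulC.
Qed.

Section Averaging.
Context {R : realType} {n p : nat}.
Hypothesis n_gt0 : (0 < n)%N.
Local Notation P := (n%:R^-1 *: const_mx 1 : 'M[R]_n).

Let n_neq0 : n%:R != 0 :> R. Proof. by rewrite pnatr_eq0 -lt0n. Qed.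

Lemma stack_xbar (X : 'M[R]_(n, p)) : stack n (xbar X) = P *m X.
Proof.
apply/matrixP => i j; rewrite !mxE mulr_sumr.
by apply: eq_bigr => l _; rewrite !mxE mulr1.
Qed.

Lemma mul_avg_mx_l (W : 'M[R]_n) : (forall j, \sum_i W i j = 1) -> P *m W = P.
Proof.
move=> hW; apply/matrixP => i j; rewrite !mxE.
by under eq_bigr do rewrite !mxE mulr1; rewrite -mulr_sumr hW.
Qed.

Lemma mul_avg_mx_r (W : 'M[R]_n) : (forall i, \sum_j W i j = 1) -> W *m P = P.
Proof.
move=> hW; apply/matrixP => i j; rewrite !mxE.
by under eq_bigr do rewrite !mxE mulr1; rewrite -mulr_suml hW mul1r mulr1.
Qed.

Lemma avg_mx_idem : P *m P = P.
Proof.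
apply: mul_avg_mx_l => j; under eq_bigr do rewrite !mxE mulr1.
by rewrite sumr_const card_ord -[_ *+ _]mulr_natl mulfV.
Qed.

(** [P] is symmetric and idempotent, hence |PX|^2 = <X, PX> <= |X| |PX|. *)
Lemma e2norm_avg_mx_le (X : 'M[R]_(n, p)) : e2norm (P *m X) <= e2norm X.
Proof.
have PT : P^T = P by apply/matrixP => i j; rewrite !mxE.
have h : e2norm (P *m X) * e2norm (P *m X) <= e2norm X * e2norm (P *m X).
  rewrite -expr2 e2norm_sqr frob_mulmxl PT mulmxA avg_mx_idem.
  exact: frob_le.
have := e2norm_ge0 (P *m X); rewrite le_eqVlt => /predU1P[<-|].
  exact: e2norm_ge0.
by move=> /ler_pM2r <-.
Qed.

Lemma e2norm_stack_xbar_sub (X Y : 'M[R]_(n, p)) :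
  e2norm (stack n (xbar X) - stack n (xbar Y)) <= e2norm (X - Y).
Proof. by rewrite !stack_xbar -mulmxBr e2norm_avg_mx_le. Qed.

Lemma row_stack i (v : 'rV[R]_p) : row i (stack n v) = v.
Proof. by apply/rowP => j; rewrite !mxE. Qed.

Lemma e2norm_stack (v : 'rV[R]_p) : e2norm (stack n v) = Num.sqrt n%:R * e2norm v.
Proof.
rewrite !e2norm_frob -sqrtrM ?ler0n// frob_sum_row.
by under eq_bigr do rewrite row_stack; rewrite sumr_const card_ord mulr_natl.
Qed.

Lemma e2norm_stack_le (u v : 'rV[R]_p) :
  (e2norm (stack n u) <= e2norm (stack n v)) = (e2norm u <= e2norm v).
Proof. by rewrite !e2norm_stack ler_pM2l// sqrtr_gt0 ltr0n. Qed.

Lemma stackD (u v : 'rV[R]_p) : stack n (u + v) = stack n u + stack n v.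
Proof. by apply/matrixP => i j; rewrite !mxE. Qed.

Lemma stackN (u : 'rV[R]_p) : stack n (- u) = - stack n u.
Proof. by apply/matrixP => i j; rewrite !mxE. Qed.

Lemma stackZ (a : R) (u : 'rV[R]_p) : stack n (a *: u) = a *: stack n u.
Proof. by apply/matrixP => i j; rewrite !mxE. Qed.

Section DoublyStochastic.
Context {W : 'M[R]_n}.
Hypothesis dsW : doubly_stochastic W.

Lemma mul_avg_mx_exp t : P *m W ^+ t = P.
Proof.
case: dsW => _ _ cW; elim: t => [|t IH]; first by rewrite expr0 mulmx1.
by rewrite exprS -[W * _]/(W *m _) mulmxA mul_avg_mx_l.
Qed.

(** The cross terms collapse since P W^t = W P = P P = P. At t = 0 the identity fails: the left side
    is 1 and the right side 1 - P. *)
Lemma exp_sub_avg_mx t : (0 < t)%N -> (W - P) ^+ t = W ^+ t - P.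
Proof.
case: dsW => _ rW _; case: t => // t _; elim: t => [|t IH]; first by rewrite !expr1.
rewrite exprS IH mulrBl !mulrBr -exprS.
rewrite -[P * W ^+ _]/(P *m _) -[P * P]/(P *m _) -[W * P]/(W *m _).
by rewrite mul_avg_mx_exp avg_mx_idem mul_avg_mx_r// subrr subr0.
Qed.
End DoublyStochastic.

Section AverageGradient.
Context {fs : 'I_n -> 'rV[R]_p -> R} {L : R}.
Hypothesis fsL : forall i, L_smooth L (fs i).
Hypothesis L_ge0 : 0 <= L.

Lemma e2norm_gradF_sub (X Y : 'M[R]_(n, p)) :
  e2norm (gradF fs X - gradF fs Y) <= L * e2norm (X - Y).
Proof.
apply: e2norm_le_row => // i.
have := fsL i (row i X) (row i Y).
have -> : row i (X - Y) = row i X - row i Y by apply/rowP => j; rewrite !mxE.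
by congr (e2norm _ <= _); apply/rowP => j; rewrite !mxE.
Qed.

(** The gradient of [avg_fun fs], written through the stacked gradient so that bounds on [gradF] and
    on averaging apply directly. *)
Definition avg_grad (x : 'rV[R]_p) : 'rV[R]_p := xbar (gradF fs (stack n x)).

Lemma avg_gradE x : avg_grad x = n%:R^-1 *: \sum_i grad (fs i) x.
Proof.
apply/rowP => j; rewrite /avg_grad /xbar [LHS]mxE [RHS]mxE summxE.
congr (_ * _); apply: eq_bigr => i _.
by rewrite mxE row_stack.
Qed.

(** Multiplying by sqrt n moves both sides to stacked vectors, where averaging is nonexpansive and
    [gradF] is L-Lipschitz. *)
Lemma avg_grad_lipschitz x y :
  e2norm (avg_grad x - avg_grad y) <= L * e2norm (x - y).
Proof.
have s0 : 0 < Num.sqrt n%:R :> R by rewrite sqrtr_gt0 ltr0n.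
rewrite -(ler_pM2l s0) [leRHS]mulrCA -2!e2norm_stack 2!stackD 2!stackN.
exact: le_trans (e2norm_stack_xbar_sub _ _)
  (e2norm_gradF_sub (stack n x) (stack n y)).
Qed.

Lemma is_derive_avg_fun (x v : 'rV[R]_p) :
  (forall i x, differentiable (fs i) x) ->
  is_derive x v (avg_fun fs) (frob (avg_grad x) v).
Proof.
move=> dfs.
have -> : avg_fun fs = n%:R^-1 \*: (\sum_i fs i).
  by apply/funext => y; rewrite /avg_fun fct_sumE.
have -> : frob (avg_grad x) v = n%:R^-1 *: \sum_i frob (grad (fs i) x) v.
  rewrite avg_gradE frobZl; congr (_ * _).
  by apply: (big_morph (fun A => frob A v)) => [A B|]; rewrite ?frobDl// -(scale0r 0) frobZl mul0r.
apply/is_deriveZ/is_derive_sum => i; rewrite frob_grad.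
by apply: DeriveDef; [exact: diff_derivable | exact: deriveE].
Qed.
End AverageGradient.
End Averaging.

(** * Boundedness from summable perturbations *)

Section Recurrence.
Context {R : realType}.
Implicit Types b u E d : R^nat.

(** Since 1 + x <= exp x, the product of the growth factors is at most the exponential of a partial
    sum, itself below the limit of the series. *)
Lemma gronwall_bounded (C : R) b u : 0 <= C ->
  (forall k, 0 <= b k) -> cvgn (series b) -> (forall k, 0 <= u k) ->
  (forall k, u k.+1 <= (1 + C * b k) * u k) ->
  exists M, forall k, u k <= M.
Proof.
move=> C0 b0 cb u0 urec.
have uexp k : u k <= expR (C * series b k) * u 0%N.
  elim: k => [|k IH]; first by rewrite /series/= big_geq// mulr0 expR0 mul1r.
  rewrite seriesSr mulrDr addrC expRD -mulrA; apply: le_trans (urec k) _.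
  by apply: ler_pM => //; [rewrite addr_ge0 ?mulr_ge0 | exact: expR_ge1Dx].
exists (expR (C * limn (series b)) * u 0%N) => k.
apply: le_trans (uexp k) _; rewrite ler_wpM2r// ler_expR ler_wpM2l//.
apply: nondecreasing_cvgn_le => //; exact: nondecreasing_series.
Qed.

Lemma coupled_recurrence_bounded (m K : R) b E d : 0 <= m -> 0 <= K ->
  (forall k, 0 <= b k) -> cvgn (series b) ->
  (forall k, 0 <= E k) -> (forall k, 0 <= d k) ->
  (forall k, E k.+1 <= E k + m * d k) ->
  (forall k, d k.+1 <= b k * ((1 + m) * (E k + d k) + K)) ->
  exists M, forall k, E k + d k <= M.
Proof.
move=> m0 K0 b0 cb E0 d0 Erec drec.
(* The weight 1 + m on [d] absorbs the term m d of the recursion for [E]; adding [K] makes the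
   recursion for [d] homogeneous in [V]. *)
pose V k := E k + (1 + m) * d k + K.
have EdV k : E k + d k + K <= V k.
  by rewrite /V; have := mulr_ge0 m0 (d0 k); lra.
have [|||M VM] := @gronwall_bounded ((1 + m) ^+ 2) b V _ b0 cb.
- exact: sqr_ge0.
- by move=> k; apply: le_trans (EdV k); have := E0 k; have := d0 k; lra.
- move=> k.
  have h1 : (1 + m) * d k.+1 <= (1 + m) ^+ 2 * b k * V k.
    apply: (@le_trans _ _ ((1 + m) * (b k * ((1 + m) * V k)))); last by lra.
    rewrite ler_wpM2l ?addr_ge0//; apply: le_trans (drec k) _.
    rewrite ler_wpM2l//; have := EdV k; have := mulr_ge0 m0 K0.
    by move=> mK /(@ler_wpM2l _ (1 + m)); rewrite addr_ge0// => /(_ isT); lra.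
  by have := Erec k; have := d0 k; rewrite /V in h1 *; lra.
by exists M => k; have := EdV k; have := VM k; lra.
Qed.
End Recurrence.

(** * The iteration for an abstract Lipschitz map [G] in place of the stacked gradient *)

Section InexactConsensus.
Context {R : realType} {n p : nat} {W : 'M[R]_n}.
Context {G : 'M[R]_(n, p) -> 'M[R]_(n, p)} {mu L : R} {t : nat -> nat}.
Context {X : nat -> 'M[R]_(n, p)} {xs : 'rV[R]_p}.
Hypothesis n_gt0 : (0 < n)%N.
Hypothesis dsW : doubly_stochastic W.
Hypothesis mu_ge0 : 0 <= mu.
Hypothesis L_ge0 : 0 <= L.
Hypothesis G_lipschitz : forall Y Z, e2norm (G Y - G Z) <= L * e2norm (Y - Z).
Hypothesis G_step : forall x,
  e2norm (stack n (x - mu *: xbar (G (stack n x)) - xs)) <=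
  e2norm (stack n (x - xs)).
Hypothesis t_gt0 : forall k, (0 < t k)%N.
Hypothesis XE : forall k, X k.+1 = W ^+ t k *m (X k - mu *: G (X k)).

Local Notation P := (n%:R^-1 *: const_mx 1 : 'M[R]_n).

(** [Z] is a fixed reference point, later the stacked minimizer. The term in [G Z] remains because
    the individual gradients need not vanish there, only their average. *)
Lemma e2norm_step_le Y Z :
  e2norm (Y - mu *: G Y) <=
  (1 + mu * L) * e2norm (Y - Z) + (e2norm Z + mu * e2norm (G Z)).
Proof.
have -> : Y - mu *: G Y = (Y - Z) + (- (mu *: (G Y - G Z)) + (Z - mu *: G Z)).
  by apply/matrixP => i j; rewrite !mxE; ring.
have h1 := e2normD (Y - Z) (- (mu *: (G Y - G Z)) + (Z - mu *: G Z)).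
have h2 := e2normD (- (mu *: (G Y - G Z))) (Z - mu *: G Z).
have h3 := e2normD Z (- (mu *: G Z)).
move: h2 h3; rewrite !e2normN !e2normZ !(ger0_norm mu_ge0) => h2 h3.
by have := ler_wpM2l mu_ge0 (G_lipschitz Y Z); lra.
Qed.

Lemma xbar_rec k :
  stack n (xbar (X k.+1)) = stack n (xbar (X k - mu *: G (X k))).
Proof. by rewrite XE !stack_xbar mulmxA mul_avg_mx_exp. Qed.

(** Mixing preserves the average, so the error is (W^t - P) applied to the gradient step, that is (W
    - P)^t applied to it. *)
Lemma consensus_error_rec k :
  e2norm (stack n (xbar (X k.+1)) - X k.+1) <=
  spec_norm (W - P) ^+ t k * e2norm (X k - mu *: G (X k)).
Proof.
rewrite xbar_rec stack_xbar XE e2norm_subC -mulmxBl.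
rewrite -(exp_sub_avg_mx n_gt0 dsW _ (t_gt0 k)); exact: e2norm_expmx_spec.
Qed.

(** The new average is an exact gradient step at the old one plus the error of evaluating [G] at
    [X k] instead of at the stacked average. *)
Lemma average_error_rec k :
  e2norm (stack n (xbar (X k.+1)) - stack n xs) <=
  e2norm (stack n (xbar (X k)) - stack n xs) +
  mu * L * e2norm (stack n (xbar (X k)) - X k).
Proof.
set x := xbar (X k); set GZ := G (stack n x).
have -> : stack n (xbar (X k.+1)) - stack n xs =
    stack n (x - mu *: xbar GZ - xs) +
    mu *: (stack n (xbar GZ) - stack n (xbar (G (X k)))).
  rewrite xbar_rec !stackD !stackN stackZ !stack_xbar mulmxBr -scalemxAr.
  rewrite -/x; apply/matrixP => i j; rewrite !mxE; ring.
apply: le_trans (e2normD _ _) _; apply: lerD.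
  by apply: le_trans (G_step x) _; rewrite stackD stackN.
rewrite e2normZ ger0_norm// -mulrA ler_wpM2l//.
exact: le_trans (e2norm_stack_xbar_sub n_gt0 _ _) (G_lipschitz _ _).
Qed.

Lemma near_dgd_bounded : cvgn (series (fun k => spec_norm (W - P) ^+ t k)) ->
  exists M, forall k,
    e2norm (stack n (xbar (X k)) - stack n xs) <= M /\
    e2norm (stack n (xbar (X k.+1)) - X k.+1) <= M * spec_norm (W - P) ^+ t k.
Proof.
move=> cb; set b := fun k => _ in cb.
pose E k := e2norm (stack n (xbar (X k)) - stack n xs).
pose d k := e2norm (stack n (xbar (X k)) - X k).
pose K := e2norm (stack n xs) + mu * e2norm (G (stack n xs)).
have muL0 : 0 <= mu * L by rewrite mulr_ge0.
have K0 : 0 <= K by rewrite addr_ge0 ?mulr_ge0 ?e2norm_ge0.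
have b0 k : 0 <= b k by rewrite exprn_ge0// spec_norm_ge0.
have step k : e2norm (X k - mu *: G (X k)) <= (1 + mu * L) * (E k + d k) + K.
  (* The distance from [X k] to the stacked minimizer is split at the stacked average into [d k] and
     [E k]. *)
  apply: le_trans (e2norm_step_le (X k) (stack n xs)) _.
  rewrite lerD2r ler_wpM2l ?addr_ge0// /E /d [in leRHS]addrC.
  rewrite [in X in _ <= X + _]e2norm_subC; apply: le_trans (e2normD _ _).
  by rewrite subrKA.
have drec k : d k.+1 <= b k * ((1 + mu * L) * (E k + d k) + K).
  exact: le_trans (consensus_error_rec k) (ler_wpM2l (b0 k) (step k)).
have [||M EdM] := coupled_recurrence_bounded (mu * L) K b E d muL0 K0 b0 cb _ _
  average_error_rec drec; [by move=> k; exact: e2norm_ge0..|].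
have M0 : 0 <= M by apply: le_trans (EdM 0%N); rewrite addr_ge0 ?e2norm_ge0.
(* This is the factor of b in [drec] once E + d <= M; it also dominates [M], so one constant serves
   both bounds. *)
exists ((1 + mu * L) * M + K) => k; split.
  apply: (@le_trans _ _ (E k + d k)); first by rewrite lerDl e2norm_ge0.
  by apply: le_trans (EdM k) _; have := mulr_ge0 muL0 M0; lra.
apply: le_trans (drec k) _; rewrite mulrC ler_wpM2r ?b0// lerD2r.
by rewrite ler_wpM2l ?addr_ge0.
Qed.
End InexactConsensus.

(** * Application to NEAR-DGD+ with [gradF fs] and the largest smoothness constant *)

Theorem theorem2p3 (R : realType) (n p : nat) (W : 'M[R]_n)
  (fs : 'I_n -> 'rV[R]_p -> R) (Ls : 'I_n -> R) (mu : R) (t : nat -> nat)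
  (X : nat -> 'M[R]_(n, p)) (xs : 'rV[R]_p) :
  doubly_stochastic W -> strongly_connected W -> self_loops W ->
  (forall i x, differentiable (fs i) x) ->
  convex_fun (avg_fun fs) ->
  (forall i, 0 < Ls i) ->
  (forall i, L_smooth (Ls i) (fs i)) ->
  0 < mu -> mu <= 2 / (\big[Num.max/0]_i Ls i) ->
  (forall k, (1 <= t k)%N) ->
  cvgn (series (fun k => spec_norm (W - n%:R^-1 *: const_mx 1) ^+ t k)) ->
  near_dgd_plus W fs mu t X ->
  (forall x, avg_fun fs xs <= avg_fun fs x) ->
  (exists C : R, \forall k \near \oo,
      e2norm (stack n (xbar (X k)) - stack n xs) <= C) /\
  (exists C : R, \forall k \near \oo,
      e2norm (stack n (xbar (X k.+1)) - X k.+1)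
        <= C * spec_norm (W - n%:R^-1 *: const_mx 1) ^+ t k).
Proof.
move=> dsW _ _ dfs fcvx _ fsLs mu0; set L := \big[_/_]_i _ => muL t1 cb XE fmin.
have L_ge0 : 0 <= L by exact: bigmax_ge_id.
(* Division by zero yields 0 here, so L = 0 would turn the step-size bound into mu <= 0. *)
have L_neq0 : L != 0.
  by apply/eqP => L0; move: muL; rewrite L0 invr0 mulr0 leNgt mu0.
have L_gt0 : 0 < L by rewrite lt0r L_neq0.
(* For n = 0 the maximum is empty and takes its default value 0, contradicting [L_neq0]. *)
have n_gt0 : (0 < n)%N.
  rewrite lt0n; apply: contra_neq L_neq0 => n0.
  by apply: bigmax_eq_id => i; have := ltn_ord i; rewrite {2}n0.
have fsL i : L_smooth L (fs i).
  move=> x y; apply: le_trans (fsLs i x y) _.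
  by rewrite ler_wpM2r ?e2norm_ge0// /L le_bigmax.
have G_step x : e2norm (stack n (x - mu *: xbar (gradF fs (stack n x)) - xs)) <=
    e2norm (stack n (x - xs)).
  rewrite e2norm_stack_le//.
  apply: (gradient_step_le (avg_fun fs) (avg_grad (fs := fs)) L mu x xs) => //.
  - by rewrite (ltW mu0).
  - by move=> y v; exact: is_derive_avg_fun.
  - by move=> y z; exact: avg_grad_lipschitz.
have [M hM] := near_dgd_bounded n_gt0 dsW (ltW mu0) L_ge0
  (e2norm_gradF_sub fsL L_ge0) G_step t1 XE cb.
by split; exists M; apply: nearW => k; have [] := hM k.
Qed.
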